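(* Let $A$ be a positive $n \times n$ matrix with ($n$ pairwise) distinct eigenvalues. Let $B_1, B_2, \ldots, B_k$ be positive $n\times n$ matrices such that $[A, B_i] \ge 0$ for all $i=1, \ldots, k$. Then the unital algebra $\mathcal{A}$ generated by $A, B_1, B_2, \ldots, B_k$ is triangularizable, and so its dimension is at most $n(n+1)/2$.
   Context: A matrix is called positive if all its entries are nonnegative real numbers; $M \ge 0$ means that $M$ is positive in this sense. $[A,B] = AB - BA$. Matrices are regarded as operators on $\mathbb{C}^n$, algebras and dimensions are taken over $\mathbb{C}$, and eigenvalues are complex. A family of $n\times n$ matrices is triangularizable if there is a basis of $\mathbb{C}^n$ with respect to which all members of the family have upper triangular representation. *)

(* Defs.v *)
From HB Require Import structures.
From mathcomp Require Import all_boot all_order all_algebra all_field.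
From mathcomp Require Import complex reals.

Set Implicit Arguments.
Unset Strict Implicit.
Unset Printing Implicit Defensive.

Import Order.TTheory GRing.Theory Num.Theory.

Local Open Scope ring_scope.

(* Over R[i], [0 <= z] means that z is real and nonnegative. *)
Definition mx_nonneg (R : realType) (m n : nat) (M : 'M[R[i]]_(m, n)) : Prop :=
  forall i j, 0 <= M i j.

Definition mx_comm (K : pzRingType) (n : nat) (M N : 'M[K]_n) : 'M[K]_n :=
  M *m N - N *m M.

Definition has_distinct_eigenvalues (K : fieldType) (n : nat) (M : 'M[K]_n) :
    Prop :=
  exists2 s : n.-tuple K, uniq s & forall a, a \in s -> eigenvalue M a.

Definition upper_triangular (K : nmodType) (n : nat) (M : 'M[K]_n) : Prop :=
  forall i j : 'I_n, (j < i)%N -> M i j = 0.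

(* The columns of P form the basis; matrices act on column vectors. *)
Definition triangularizable (K : fieldType) (n : nat) (S : {pred 'M[K]_n}) :
    Prop :=
  exists2 P : 'M[K]_n, P \in unitmx &
    forall M, M \in S -> upper_triangular (invmx P *m M *m P).

(* [agenv U] contains 1 = U ^+ 0 and all powers of U, so this is the unital
   subalgebra generated by s; MathComp has an algebra structure on square
   matrices only in size n.+1. *)
Definition generated_algebra (K : fieldType) (n : nat) (s : seq 'M[K]_n.+1) :
    {vspace 'M[K]_n.+1} := agenv <<s>>%VS.

(* Main.v *)
(* Let S be the sum of A and the B_l, and C_l = [A, B_l].  The trace of
   [A, S] S^m vanishes for every m and all its terms are nonnegative, so an
   entry (i, j) of some C_l can be nonzero only if j does not reach i in the
   graph of S; as i then reaches j, j reaches strictly fewer indices than i.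
   Polynomials in A, in particular the multiples of its spectral projections,
   have a nonzero (i, j) entry only if j reaches at most as many indices as i.
   In a basis of left eigenvectors v_p of A, with eigenvalues a_p, C_l has the
   entries (a_p - a_q) (B_l)_pq; so if (B_l)_pq <> 0 with p <> q, then C_l
   followed by the projection onto v_q maps v_p to a nonzero multiple of v_q.
   Hence v_q has smaller height than v_p, the height of v being the largest
   number of indices reached from an index in the support of v.  Sorting the
   eigenvectors by decreasing height makes all the B_l upper triangular. *)
Require Import Defs.
From mathcomp Require Import all_boot all_order all_algebra all_field.
From mathcomp Require Import complex reals.

Set Implicit Arguments.
Unset Strict Implicit.
Unset Printing Implicit Defensive.

Import Order.TTheory GRing.Theory Num.Theory.

Local Open Scope ring_scope.

(** * Nonnegative matrices and the graph of their nonzero entries *)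

Lemma mulmx_entry_neq0 (K : pzSemiRingType) (m n p : nat)
    (M : 'M[K]_(m, n)) (N : 'M[K]_(n, p)) i j :
  (M *m N) i j != 0 -> exists2 k, M i k != 0 & N k j != 0.
Proof.
rewrite mxE => MN_neq0.
have /existsP[k /andP[Mik Nkj]] : [exists k, (M i k != 0) && (N k j != 0)].
  apply: contraNT MN_neq0 => /existsPn MN0; apply/eqP/big1 => k _.
  have := MN0 k; rewrite negb_and !negbK => /orP[] /eqP->.
    by rewrite mul0r.
  by rewrite mulr0.
by exists k.
Qed.

Definition support_rel (K : nmodType) (n : nat) (M : 'M[K]_n) : rel 'I_n :=
  fun i j => M i j != 0.

Lemma expmx_ge0 (K : numDomainType) (n : nat) (M : 'M[K]_n.+1) (k : nat) :
  (forall i j, 0 <= M i j) -> forall i j, 0 <= (M ^+ k) i j.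
Proof.
move=> M_ge0; elim: k => [|k IHk] i j; first by rewrite mxE; case: eqP.
by rewrite exprS mxE sumr_ge0 // => l _; rewrite mulr_ge0.
Qed.

(** The product of the entries along the path is one term of the expanded power, and nonnegative
    terms cannot cancel it. *)
Lemma expmx_path_neq0 (K : numDomainType) (n : nat) (M : 'M[K]_n.+1) i p :
  (forall i j, 0 <= M i j) -> path (support_rel M) i p ->
  (M ^+ size p) i (last i p) != 0.
Proof.
move=> M_ge0; elim: p i => [|j p IHp] i /=.
  by rewrite mxE eqxx oner_eq0.
case/andP=> Mij /IHp Mp; rewrite exprS mxE.
have ge0 l : true -> 0 <= M i l * (M ^+ size p) l (last j p).
  by move=> _; rewrite mulr_ge0 ?expmx_ge0.
apply: contraNneq Mp => /(psumr_eq0P ge0)/(_ j isT)/eqP.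
by rewrite mulf_eq0 (negPf Mij).
Qed.

Lemma mxtrace_mx_comm_mul (K : comPzRingType) (n : nat) (M N L : 'M[K]_n) :
  L *m N = N *m L -> \tr (mx_comm M N *m L) = 0.
Proof.
move=> LN; rewrite /mx_comm mulmxBl raddfB /= -!mulmxA -LN.
by rewrite (mulmxA M) (mxtrace_mulC (M *m L)) subrr.
Qed.

(** A path from [j] to [i] of length m makes [(S ^+ m) j i] nonzero. The trace of [A, S] S^m is zero
    and a sum of nonnegative terms, so entry (i, j) of [A, S] vanishes, and with it each summand
    [A, B_l]. *)
Lemma mx_comm_support_acyclic (K : numDomainType) (n k : nat)
    (A : 'M[K]_n.+1) (B : 'I_k -> 'M[K]_n.+1) (S := A + \sum_l B l) l i j :
  (forall i j, 0 <= S i j) ->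
  (forall l i j, 0 <= mx_comm A (B l) i j) ->
  mx_comm A (B l) i j != 0 -> ~~ connect (support_rel S) j i.
Proof.
move=> S_ge0 C_ge0 Cij; apply/negP => /connectP[p path_p last_p].
have Sk : (S ^+ size p) j i != 0 by rewrite last_p expmx_path_neq0.
have CS : mx_comm A S = \sum_l mx_comm A (B l).
  rewrite /mx_comm /S mulmxDr mulmxDl opprD addrACA subrr add0r.
  by rewrite mulmx_sumr mulmx_suml sumrB.
have term_ge0 i1 j1 : 0 <= mx_comm A S i1 j1 * (S ^+ size p) j1 i1.
  by rewrite mulr_ge0 ?expmx_ge0 // CS summxE sumr_ge0.
have row_ge0 i1 : true -> 0 <= (mx_comm A S *m S ^+ size p) i1 i1.
  by move=> _; rewrite mxE sumr_ge0.
have := @mxtrace_mx_comm_mul _ _ A S (S ^+ size p) (esym (commrX _ (erefl _))).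
move/(psumr_eq0P row_ge0)/(_ i isT); rewrite mxE.
move/(psumr_eq0P (fun l _ => term_ge0 i l))/(_ j isT)/eqP.
rewrite mulf_eq0 (negPf Sk) orbF CS summxE => /eqP C0.
by move: Cij; rewrite (psumr_eq0P (fun l _ => C_ge0 l i j) C0) ?eqxx.
Qed.

(** * Reachability counts and heights of row vectors *)

Definition reach (T : finType) (e : rel T) (x : T) : nat := #|connect e x|.

Lemma reach_connect (T : finType) (e : rel T) x y :
  connect e x y -> (reach e y <= reach e x)%N.
Proof.
move=> xy; apply: subset_leq_card; apply/subsetP => z.
exact: connect_trans.
Qed.

Lemma reach_lt (T : finType) (e : rel T) x y :
  connect e x y -> ~~ connect e y x -> (reach e y < reach e x)%N.
Proof.
move=> xy nyx; apply: proper_card; apply/properP; split.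
  by apply/subsetP => z; apply: connect_trans.
by exists x => //; apply: connect0.
Qed.

Definition lowers_weakly (K : nmodType) (n : nat) (r : 'I_n -> nat)
    (M : 'M[K]_n) : Prop :=
  forall i j, M i j != 0 -> (r j <= r i)%N.

Definition height (K : nmodType) (n : nat) (r : 'I_n -> nat)
    (v : 'rV[K]_n) : nat :=
  \max_(j | v 0 j != 0) r j.

(** The weak inequality admits the diagonal entries of scalar matrices and composes along
    products. *)
Lemma lowers_weakly_horner (K : comNzRingType) (n : nat) (r : 'I_n.+1 -> nat)
    (A : 'M[K]_n.+1) (p : {poly K}) :
  lowers_weakly r A -> lowers_weakly r (horner_mx A p).
Proof.
move=> rA; elim/poly_ind: p => [|p c IHp] i j.
  by rewrite raddf0 mxE eqxx.
rewrite rmorphD rmorphM /= horner_mx_X horner_mx_C mxE.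
have [->|] := eqVneq ((horner_mx A p * A) i j) 0.
  by rewrite add0r mxE; case: (eqVneq i j) => [->|_] //; rewrite mulr0n eqxx.
case/mulmx_entry_neq0=> k /IHp ki /rA jk _; exact: leq_trans jk ki.
Qed.

(** An index [j] attaining the height of [w] is reached from some [i] in the support of [u] through
    [l]: [C] makes [r] drop strictly from [i] to [l], and [E] does not raise it from [l] to [j]. *)
Lemma height_lt (K : fieldType) (n : nat) (r : 'I_n -> nat)
    (C E : 'M[K]_n) (u w : 'rV[K]_n) (c : K) :
  (forall i j, C i j != 0 -> (r j < r i)%N) -> lowers_weakly r E ->
  c != 0 -> w != 0 -> u *m C *m E = c *: w -> (height r w < height r u)%N.
Proof.
move=> rC rE c0 w0 uCE.
have [|j wj max_j] := @bigop.eq_bigmax_cond _ (fun j => w 0 j != 0) r.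
  by have [j wj] := rV0Pn _ w0; apply/card_gt0P; exists j.
have -> : height r w = r j by [].
have : (u *m C *m E) 0 j != 0 by rewrite uCE mxE mulf_neq0.
case/mulmx_entry_neq0=> l /mulmx_entry_neq0[i ui /rC li] /rE jl.
apply: leq_ltn_trans jl (leq_trans li _).
exact: (@leq_bigmax_cond _ (fun i => u 0 i != 0)).
Qed.

(** * Spectral projections and coordinates in an eigenbasis *)

Lemma eigenvector_horner_mx (K : comNzRingType) (n : nat) (A : 'M[K]_n.+1)
    (v : 'rV[K]_n.+1) (a : K) (p : {poly K}) :
  v *m A = a *: v -> v *m horner_mx A p = p.[a] *: v.
Proof.
move=> vA; elim/poly_ind: p => [|p c IHp].
  by rewrite raddf0 mulmx0 horner0 scale0r.
rewrite rmorphD rmorphM /= horner_mx_X horner_mx_C mulmxDr mulmxA IHp.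
by rewrite -scalemxAl vA mul_mx_scalar !hornerE scalerDl scalerA.
Qed.

(** For [s] without repetitions, an unnormalized Lagrange basis polynomial. *)
Definition root_selector (K : idomainType) (s : seq K) (a : K) : {poly K} :=
  \prod_(b <- s | b != a) ('X - b%:P).

Lemma root_selector_eq0 (K : idomainType) (s : seq K) (a b : K) :
  b \in s -> ((root_selector s a).[b] == 0) = (b != a).
Proof.
move=> bs; rewrite /root_selector horner_prod prodf_seq_eq0.
apply/hasP/idP => [[c cs] | ba]; last by exists b; rewrite // !hornerE subrr ba eqxx.
by rewrite !hornerE subr_eq0 => /andP[ca /eqP->].
Qed.

Lemma mx_comm_eigenbasis (K : fieldType) (n : nat) (A B P : 'M[K]_n)
    (d : 'I_n -> K) p q :
  P \in unitmx -> P *m A = diag_mx (\row_i d i) *m P ->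
  (P *m mx_comm A B *m invmx P) p q
    = (d p - d q) * (P *m B *m invmx P) p q.
Proof.
move=> Pu PA.
have AP : A *m invmx P = invmx P *m diag_mx (\row_i d i).
  apply: (can_inj (mulKmx Pu)); rewrite mulKVmx // mulmxA PA -mulmxA.
  by rewrite mulmxV // mulmx1.
rewrite /mx_comm mulmxBr mulmxBl [P *m (A *m B)]mulmxA PA.
rewrite -[P *m (B *m A) *m _]mulmxA -[B *m A *m _]mulmxA AP.
rewrite -!(mulmxA (diag_mx _)) mul_diag_mx [B *m (_ *m _)]mulmxA.
by rewrite !mulmxA mul_mx_diag !mxE mulrBl mulrC [in X in _ - X]mulrC mulrC.
Qed.

(** * Matrices that are triangular in a fixed basis *)

Lemma upper_triangularD (K : nmodType) (n : nat) (M N : 'M[K]_n) :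
  upper_triangular M -> upper_triangular N -> upper_triangular (M + N).
Proof. by move=> uM uN i j ji; rewrite mxE uM // uN // addr0. Qed.

Lemma upper_triangularM (K : pzSemiRingType) (n : nat) (M N : 'M[K]_n) :
  upper_triangular M -> upper_triangular N -> upper_triangular (M *m N).
Proof.
move=> uM uN i j ji; rewrite mxE big1 // => k _.
have [ki|ik] := ltnP k i; first by rewrite uM ?mul0r.
by rewrite uN ?mulr0 // (leq_trans ji).
Qed.

Section ConjugateTriangular.
Variables (K : fieldType) (n : nat) (P : 'M[K]_n.+1).
Hypothesis Pu : P \in unitmx.

(** Given by conjugated matrix units, so that counting generators bounds the dimension. *)
Definition conj_triangular : {vspace 'M[K]_n.+1} :=
  <<[seq P *m delta_mx p.1 p.2 *m invmx P
      | p in [pred p : 'I_n.+1 * 'I_n.+1 | (p.1 <= p.2)%N]]>>%VS.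

Lemma conj_triangularP M :
  M \in conj_triangular <-> upper_triangular (invmx P *m M *m P).
Proof.
split=> [/coord_span-> | uM].
  apply: (@big_ind _ (fun M => upper_triangular (invmx P *m M *m P))).
  - by move=> i j _; rewrite mulmx0 mul0mx mxE.
  - by move=> M1 M2 u1 u2; rewrite mulmxDr mulmxDl; apply: upper_triangularD.
  move=> l _; set X := image_tuple _ _.
  have /imageP[[p q] /= pq ->] : X`_l \in tval X.
    by rewrite mem_nth // size_tuple.
  move=> i j ji; rewrite -scalemxAr -scalemxAl !mulmxA mulVmx // mul1mx.
  rewrite mulmxKV // !mxE; case: andP => [[/eqP ip /eqP jq]|_].
    by move: pq; rewrite -ip -jq inE leqNgt ji.
  by rewrite mulr0.
have -> : M = P *m (invmx P *m M *m P) *m invmx P.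
  by rewrite !mulmxA mulmxV // mul1mx mulmxK.
rewrite [X in P *m X]matrix_sum_delta mulmx_sumr mulmx_suml.
apply: memv_suml => i _; rewrite mulmx_sumr mulmx_suml.
apply: memv_suml => j _.
have [ji|ij] := ltnP j i.
  by rewrite uM // scale0r mulmx0 mul0mx mem0v.
rewrite -scalemxAr -scalemxAl memvZ // memv_span //.
by apply/imageP; exists (i, j).
Qed.

Lemma dim_conj_triangular : (\dim conj_triangular <= n.+1 * n.+2 %/ 2)%N.
Proof.
apply: leq_trans (dim_span _) _; rewrite size_image -sum1_card.
rewrite -(pair_big_dep xpredT (fun i j : 'I_n.+1 => (i <= j)%N) (fun _ _ => 1%N)) /=.
rewrite (exchange_big_dep xpredT) //=.
rewrite (eq_bigr (fun j : 'I_n.+1 => j.+1)) => [|j _]; last first.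
  rewrite -[RHS]card_ord -sum1_card.
  by rewrite (big_ord_widen n.+1 (fun=> 1%N)).
(* Column [j] has [j.+1] admissible rows; prepending a zero term turns the sum into that of all i <
   n.+2, which is 'C(n.+2, 2). *)
rewrite divn2 mulnC -(bin2 n.+2) -bin2_sum big_nat_recl // add0n big_mkord.
by [].
Qed.

Lemma agenv_sub_conj_triangular (s : seq 'M[K]_n.+1) :
  (forall M, M \in s -> upper_triangular (invmx P *m M *m P)) ->
  (agenv <<s>> <= conj_triangular)%VS.
Proof.
move=> us; apply: agenv_sub_modl.
  rewrite -memvE; apply/conj_triangularP => i j ji.
  by rewrite mulmx1 mulVmx // mxE; case: eqP ji => // ->; rewrite ltnn.
have sub : (<<s>> <= conj_triangular)%VS.
  by apply/span_subvP => M Ms; apply/conj_triangularP/us.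
apply/prodvP => M N /(subvP sub)/conj_triangularP uM /conj_triangularP uN.
apply/conj_triangularP.
have -> : invmx P *m (M * N) *m P = (invmx P *m M *m P) *m (invmx P *m N *m P).
  by rewrite !mulmxA mulmxK.
exact: upper_triangularM.
Qed.

End ConjugateTriangular.

Lemma sorted_tnth_ltn (T : Type) (leT : rel T) (n : nat) (s : n.-tuple T) :
  transitive leT -> sorted leT s ->
  {homo tnth s : i j / (i < j)%N >-> leT i j}.
Proof.
move=> leT_tr s_sorted i j ij.
have x0 := tnth s i; rewrite !(tnth_nth x0).
by apply: sorted_ltn_nth; rewrite ?inE ?size_tuple.
Qed.

Theorem theorem3p2 (R : realType) (n k : nat)
    (A : 'M[R[i]]_n.+1) (B : 'I_k -> 'M[R[i]]_n.+1)
    (A_ge0 : mx_nonneg A)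
    (A_eig : has_distinct_eigenvalues A)
    (B_ge0 : forall i, mx_nonneg (B i))
    (AB_ge0 : forall i, mx_nonneg (mx_comm A (B i))) :
  let alg := generated_algebra (A :: [seq B i | i <- enum 'I_k]) in
  triangularizable alg /\ (\dim alg <= n.+1 * n.+2 %/ 2)%N.
Proof.
move=> alg; have [s0 s0_uniq s0_eig] := A_eig.
pose S := A + \sum_l B l; pose e := support_rel S; pose r := reach e.
have sumB_ge0 i j : 0 <= (\sum_l B l) i j.
  by rewrite summxE sumr_ge0 // => l _; apply: B_ge0.
have S_ge0 i j : 0 <= S i j by rewrite mxE addr_ge0.
have eA i j : A i j != 0 -> e i j.
  move=> Aij; rewrite /e /support_rel mxE paddr_eq0 //.
  by rewrite (negPf Aij).
have eB l i j : B l i j != 0 -> e i j.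
  move=> Bij; rewrite /e /support_rel mxE paddr_eq0 // negb_and.
  rewrite summxE psumr_neq0 => [|l' _]; last exact: B_ge0.
  apply/orP; right; apply/hasP; exists l; first exact: mem_index_enum.
  by rewrite /= lt_neqAle eq_sym Bij; apply: B_ge0.
have rA : lowers_weakly r A.
  by move=> i j /eA/connect1; apply: reach_connect.
have rC l i j : mx_comm A (B l) i j != 0 -> (r j < r i)%N.
  move=> Cij; apply: reach_lt; last exact: mx_comm_support_acyclic Cij.
  (* A nonzero entry of the commutator needs one in AB or BA, hence a path of length two from [i] to
     [j]. *)
  have [AB0|] := eqVneq ((A *m B l) i j) 0; last first.
    case/mulmx_entry_neq0=> h /eA ih /eB hj.
    exact: connect_trans (connect1 ih) (connect1 hj).
  move: Cij; rewrite /mx_comm mxE AB0 add0r mxE oppr_eq0.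
  case/mulmx_entry_neq0=> h /eB ih /eA hj.
  exact: connect_trans (connect1 ih) (connect1 hj).
pose v a := nz_row (eigenspace A a).
pose ge_height a b := (height r (v b) <= height r (v a))%N.
pose s := sort_tuple ge_height s0.
have s_uniq : uniq s by rewrite sort_uniq.
have s_eig a : a \in s -> eigenvalue A a by rewrite mem_sort; apply: s0_eig.
have s_sorted : sorted ge_height s.
  by apply: sort_sorted => a b; apply: leq_total.
pose d p := tnth s p.
pose Q : 'M_n.+1 := \matrix_p v (d p).
have ds p : d p \in s by apply: mem_tnth.
have d_inj p q : d p = d q -> p = q.
  by apply: tuple_uniqP.
have vA a : v a *m A = a *: v a by apply/eigenspaceP/nz_row_sub.
have v_neq0 p : v (d p) != 0 by rewrite nz_row_eq0; apply/s_eig/ds.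
pose E q := horner_mx A (root_selector s (d q)).
(* [E q] kills every eigenvector in the combination [w *m Q] except the one for [d q]. *)
have vE w q : w *m Q *m E q
    = (w 0 q * (root_selector s (d q)).[d q]) *: v (d q).
  rewrite (mulmx_sum_row w) mulmx_suml (bigD1 q) //= big1 => [|p pq].
    by rewrite addr0 rowK -scalemxAl (eigenvector_horner_mx _ (vA _)) scalerA.
  rewrite rowK -scalemxAl (eigenvector_horner_mx _ (vA _)).
  have /eqP-> : (root_selector s (d q)).[d p] == 0.
    by rewrite root_selector_eq0 //; apply: contraNneq pq => /d_inj->.
  by rewrite scale0r scaler0.
have sel_neq0 q : (root_selector s (d q)).[d q] != 0.
  by rewrite root_selector_eq0 // negbK.
(* Applying [E q] to a vanishing combination of the rows isolates its coefficient at [q]. *)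
have Qu : Q \in unitmx.
  rewrite -row_free_unit; apply: inj_row_free => w wQ.
  apply/rowP => q; rewrite mxE; apply/eqP.
  have /eqP := vE w q; rewrite wQ mul0mx eq_sym scaler_eq0 (negPf (v_neq0 q)).
  by rewrite mulf_eq0 (negPf (sel_neq0 q)) !orbF.
have QA : Q *m A = diag_mx (\row_p d p) *m Q.
  apply/row_matrixP => p; rewrite row_mul mul_diag_mx rowK vA.
  by apply/rowP => j; rewrite !mxE.
(* The rows of [Q] are left eigenvectors, so the basis of columns is the inverse of [Q]. *)
have us M : M \in A :: [seq B i | i <- enum 'I_k] ->
    upper_triangular (invmx (invmx Q) *m M *m invmx Q).
  rewrite invmxK inE => /predU1P[-> p q qp | /mapP[l _ ->] p q qp].
    rewrite QA mulmxK // !mxE; case: eqP qp => [->|]; by rewrite ?ltnn.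
  (* A nonzero entry below the diagonal would put a strictly lower eigenvector before a higher one,
     against the sorting. *)
  apply/eqP; apply: contraLR (qp) => Bpq.
  have pq : d p - d q != 0.
    by rewrite subr_eq0; apply: contraTneq qp => /d_inj->; rewrite ltnn.
  have lt_qp : (height r (v (d q)) < height r (v (d p)))%N.
    have Cpq : (Q *m mx_comm A (B l) *m invmx Q) p q != 0.
      by rewrite (mx_comm_eigenbasis _ _ _ Qu QA) mulf_neq0.
    have rE : lowers_weakly r (E q) by apply: lowers_weakly_horner.
    have c_neq0 := mulf_neq0 Cpq (sel_neq0 q).
    apply: (height_lt (rC l) rE c_neq0 (v_neq0 q)).
    (* Expanding the image of the eigenvector in the eigenbasis lets [vE] pick out the coefficient
       at [q]. *)
    have -> : v (d p) *m mx_comm A (B l)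
        = row p (Q *m mx_comm A (B l) *m invmx Q) *m Q.
      by rewrite -row_mul mulmxKV // row_mul rowK.
    by rewrite vE mxE.
  have : ge_height (d q) (d p).
    apply: (sorted_tnth_ltn _ s_sorted qp).
    by move=> x y z yx xz; apply: leq_trans xz yx.
  by rewrite /ge_height leqNgt lt_qp.
have Pu : invmx Q \in unitmx by rewrite unitmx_inv.
have sub := agenv_sub_conj_triangular Pu us.
split; last exact: leq_trans (dimvS sub) (dim_conj_triangular _).
by exists (invmx Q) => // M /(subvP sub)/conj_triangularP; apply.
Qed.
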